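(* Let $\mathcal I$ be a finite index set and let $\{T_i\}_{i\in\mathcal I}$ be a family of maps $[0,1]\to[0,1]$ generating a partition $\mathcal P$ of $[0,1]$ in the sense of the context. Suppose that the geometric potential $\gamma:\Sigma\to\mathbb R$, $\gamma(\underline x)=-\log T_{x_1}'(\pi(\sigma\underline x))$, is lattice. Then there exist a partition $\mathcal P_\ell$ of $[0,1]$ generated (in the same sense) by a family $\{T_i^\ell\}_{i\in\mathcal I}$ in which every $T_i^\ell$ is an affine function, and, for some $\alpha\in(0,1)$, a $C^{1+\alpha}$ diffeomorphism $g:[0,1]\to[0,1]$, such that for each $i\in\mathcal I$ $$T_i=g\circ T_i^\ell\circ g^{-1}.$$
   Context: Generating family. $\{T_i\}_{i\in\mathcal I}$ generates a partition $\{T_i[0,1]\}_{i\in\mathcal I}$ of $[0,1]$ if: each $T_i[0,1]$ is a closed subinterval of $[0,1]$; $T_i([0,1))\cap T_j([0,1))=\varnothing$ for $i\ne j$; $\sum_{i}\mathrm{Leb}(T_i[0,1))=1$; each $T_i$ is a strictly increasing $C^1$ diffeomorphism from $[0,1]$ onto $T_i[0,1]$, with $T_i'>0$ on $[0,1]$, and $T_i^{-1}\in C^{1+\varepsilon}$ (i.e. its derivative is $\varepsilon$-Hölder) for some $\varepsilon\in(0,1)$; there is $c_M\in(0,1)$ with $0<T_i'(x)<c_M<1$ for all $i\in\mathcal I$, $x\in[0,1]$. $\Sigma=\mathcal I^{\mathbb N}$ is the set of sequences $\underline x=(x_1,x_2,\dots)$ with the product topology, $\sigma$ is the left shift, and $\pi(\underline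 x)=\lim_nT_{x_1}\circ\cdots\circ T_{x_n}(0)$. For $\gamma\in C(\Sigma)$ and $\rho\in(0,1)$: $\mathrm{var}_n(\gamma)=\sup\{|\gamma(x)-\gamma(y)|:x_j=y_j,\ 1\le j\le n\}$; $\gamma\in\mathcal F_\rho(\Sigma)$ iff $\sup_{n\ge1}\rho^{-n}\mathrm{var}_n(\gamma)<\infty$; $\mathcal F_\rho^b(\Sigma)$ is the subset of bounded functions. $\gamma,\zeta\in\mathcal F_\rho(\Sigma)$ are cohomologous if $\gamma-\zeta=\varphi-\varphi\circ\sigma$ for some $\varphi\in\mathcal F^b_\rho(\Sigma)$. $\gamma$ is lattice if it is cohomologous (for some $\rho$) to a function taking values in a discrete subgroup of $\mathbb R$. *)

(* Defs.v *)
From mathcomp Require Import all_boot all_order all_algebra.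
From mathcomp Require Import all_classical all_reals all_analysis.

Set Implicit Arguments.
Unset Strict Implicit.
Unset Printing Implicit Defensive.

Import Order.TTheory GRing.Theory Num.Theory.
Import numFieldNormedType.Exports.

Local Open Scope classical_set_scope.
Local Open Scope ring_scope.

(* A map between intervals is a total function R -> R of which only the values
   on the relevant interval A matter; derivatives are taken within A, hence are
   one-sided at the endpoints of A. *)
Section Differentiability.
Context {R : realType}.
Implicit Types (A B : set R) (f : R -> R) (a x : R).

Definition derivable_in A f x : Prop :=
  cvg ((f y - f x) / (y - x) @[y --> within A x^']).

Definition deriv_in A f x : R :=
  lim ((f y - f x) / (y - x) @[y --> within A x^']).

Definition C1_in A f : Prop :=
  (forall x, A x -> derivable_in A f x) /\
  {within A, continuous (deriv_in A f)}.

Definition holder_in a A f : Prop :=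
  exists C : R, forall x y, A x -> A y -> `|f x - f y| <= C * `|x - y| `^ a.

Definition C1holder_in a A f : Prop :=
  C1_in A f /\ holder_in a A (deriv_in A f).

Definition inverse_on A f : R -> R := 'pinv_(fun=> 0) A f.

Definition C1_diffeo A B f : Prop :=
  [/\ set_bij A B f, C1_in A f & C1_in B (inverse_on A f)].

Definition C1holder_diffeo a A B f : Prop :=
  [/\ set_bij A B f, C1holder_in a A f & C1holder_in a B (inverse_on A f)].

Definition affine_on A f : Prop :=
  exists a b : R, forall x, A x -> f x = a * x + b.

End Differentiability.

Definition generates {R : realType} {I : finType}
    (T : I -> R -> R) (P : I -> set R) : Prop :=
  [/\ (forall i, P i = T i @` `[0, 1]) /\
      (forall i, exists a b : R,
         [/\ 0 <= a, a <= b, b <= 1 & T i @` `[0, 1] = `[a, b]%classic]),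
      forall i j, i != j -> T i @` `[0, 1[ `&` T j @` `[0, 1[ = set0,
      (\sum_(i : I) lebesgue_measure (T i @` `[0%R, 1%R[) = 1)%E,
      forall i,
        [/\ {in `[0, 1] &, {homo T i : x y / x < y}},
            C1_diffeo `[0, 1] (T i @` `[0, 1]) (T i),
            forall x : R, x \in `[0, 1] -> 0 < deriv_in `[0, 1] (T i) x &
            exists2 eps : R, 0 < eps < 1 &
              C1holder_in eps (T i @` `[0, 1]) (inverse_on `[0, 1] (T i))] &
      exists2 cM : R, 0 < cM < 1 &
        forall i (x : R), x \in `[0, 1] -> 0 < deriv_in `[0, 1] (T i) x < cM].

(* Sequences are indexed from 0: the n-th letter x_n is [x n.-1]. *)
Definition Sigma (I : finType) : topologicalType :=
  prod_topology (fun _ : nat => discrete_topology I).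

Section Symbolic.
Context {R : realType} {I : finType}.
Implicit Types (x y : Sigma I) (gamma zeta phi : Sigma I -> R) (rho : R).

Definition shift x : Sigma I := fun n => x n.+1.

Definition var (n : nat) gamma : \bar R :=
  ereal_sup [set r | exists x y,
    (forall j, (j < n)%N -> x j = y j) /\ r = (`|gamma x - gamma y|)%:E].

Definition F_class rho gamma : Prop :=
  continuous gamma /\
  (ereal_sup [set (rho ^- n)%:E * var n gamma | n in [set n | (1 <= n)%N]]
     < +oo)%E.

Definition Fb_class rho gamma : Prop :=
  F_class rho gamma /\ bounded_fun gamma.

Definition cohomologous rho gamma zeta : Prop :=
  [/\ F_class rho gamma, F_class rho zeta &
      exists2 phi, Fb_class rho phi &
        forall x, gamma x - zeta x = phi x - phi (shift x)].

Definition discrete_subgroup (G : set R) : Prop :=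
  [/\ G 0, (forall a b, G a -> G b -> G (a - b)) & G `<=` isolated G].

Definition lattice gamma : Prop :=
  exists2 rho : R, 0 < rho < 1 &
  exists2 zeta, cohomologous rho gamma zeta &
  exists2 G : set R, discrete_subgroup G & forall x, G (zeta x).

(* The n-th term T_{x_1} o ... o T_{x_n} (0) is a right fold over the first
   n letters of x. *)
Definition coding (T : I -> R -> R) x : R :=
  lim ((foldr T 0 (mkseq x n)) @[n --> \oo]).

Definition geometric_potential (T : I -> R -> R) x : R :=
  - ln (deriv_in `[0, 1] (T (x 0%N)) (coding T (shift x))).

End Symbolic.

(* Main.v *)
Require Import Defs.
From mathcomp Require Import all_boot all_order all_algebra.
From mathcomp Require Import all_classical all_reals all_analysis.
From mathcomp Require Import ring lra.

(** Write gamma for the geometric potential and let zeta, phi be the functions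
    with gamma - zeta = phi - phi o shift, where zeta takes its values in a
    discrete group G.  Fix one letter i0.  Because T_i0 contracts and its log
    derivative is Holder, the series
      L(s) = sum over k of (ln T_i0'(T_i0^k 0) - ln T_i0'(T_i0^k s))
    converges to a Holder function ([branch_potential_holder]), and a primitive
    of exp(- L) conjugates T_i0 to an affine map.  The point is that, in the
    lattice case, the same primitive linearises every other branch.

    To see this, let x and y code s and t.  The partial sums of L(s) - L(t) are
    differences of Birkhoff sums of gamma along the sequences i0 ... i0 x and
    i0 ... i0 y.  The coboundary equation turns them into an element of G, plus
    phi(y) - phi(x), plus a term that tends to 0 since phi varies little between
    sequences with a long common prefix.  Hence L(s) - L(t) + phi(x) - phi(y)
    lies in G ([branch_potential_cohomology]).  Applied to s, t and to their
    images under T_j, this shows that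
      D_j(s) = - ln T_j'(s) + L(T_j s) - L(s)
    satisfies D_j(s) - D_j(t) in G.  But D_j is continuous on the connected set
    [0, 1] and G is discrete, so D_j is constant, that is
      T_j'(s) = lam_j exp(L(T_j s) - L(s))     ([derivative_coboundary]).

    Let F be a multiple of a primitive of exp(- L) that maps [0, 1] onto itself.
    Then (F o T_j)' = lam_j F', so F o T_j = lam_j F + F(T_j 0)
    ([linearised_branch]): the chart F turns every branch into an affine map,
    and g is the inverse of F, whose derivative, a multiple of exp(L o g), is
    Holder ([chart_inverse_diffeo]).

    Finiteness of the alphabet enters through [full_measure_Ico_cover]: finitely
    many disjoint half-open intervals of total length 1 cover [0, 1) without
    exception.  This provides a coding of every point, and it shows that the
    images of the intervals under F still have total length 1
    ([linearised_generates]). *)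

Set Implicit Arguments.
Unset Strict Implicit.
Unset Printing Implicit Defensive.

Import Order.TTheory GRing.Theory Num.Theory.
Import numFieldNormedType.Exports.

Local Open Scope classical_set_scope.
Local Open Scope ring_scope.

(** * Derivatives within a set *)

Section DerivativeWithinASet.
Context {R : realType}.
Implicit Types (A B : set R) (f g : R -> R) (x y : R).

Definition has_deriv_in A f x (l : R) : Prop :=
  (f y - f x) / (y - x) @[y --> within A x^'] --> l.

(** Without the quotient there is no exceptional point [y = x] to carry along,
    so that the rules of calculus below become plain estimates. *)
Lemma has_deriv_inP A f x l :
  has_deriv_in A f x l <->
  forall e, 0 < e -> exists2 d, 0 < d &
    forall y, A y -> `|y - x| < d -> `|f y - f x - l * (y - x)| <= e * `|y - x|.
Proof.
split=> [/cvgrPdist_le h e e0|h].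
- have /nbhs_ballP[d /= d0 hd] := h e e0; exists d => // y Ay yd.
  have [->|yx] := eqVneq y x; first by rewrite !subrr mulr0 subr0 normr0 mulr0.
  have /= := hd y; rewrite /ball /= distrC => /(_ yd yx Ay).
  have yx0 : y - x != 0 by rewrite subr_eq0.
  rewrite -(@ler_pM2r _ `|y - x|) ?normr_gt0// -normrM mulrBl mulfVK//.
  by rewrite distrC.
- apply/cvgrPdist_le => e e0; have [d d0 hd] := h e e0.
  apply/nbhs_ballP; exists d => //= y; rewrite /ball /= distrC => yd yx Ay.
  have yx0 : y - x != 0 by rewrite subr_eq0.
  rewrite -(@ler_pM2r _ `|y - x|) ?normr_gt0// -normrM mulrBl mulfVK//.
  by rewrite distrC; exact: hd.
Qed.

Lemma limit_point_itvcc (a b x : R) :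
  a < b -> a <= x <= b -> limit_point `[a, b]%classic x.
Proof.
move=> ab /andP[ax xb] U /nbhs_ballP[d /= d0 dU].
have [xltb|bx] := ltP x b.
- pose m := Num.min (d / 2) (b - x).
  have m0 : 0 < m by rewrite lt_min divr_gt0//= subr_gt0.
  have md : m <= d / 2 by rewrite ge_min lexx.
  have mb : m <= b - x by rewrite ge_min lexx orbT.
  exists (x + m); split; first by rewrite -subr_eq0 addrAC subrr add0r ?oppr_eq0 gt_eqF.
    by rewrite /= in_itv /=; apply/andP; split; lra.
  by apply: dU; rewrite /ball /= ltr_norml; apply/andP; split; lra.
- pose m := Num.min (d / 2) (b - a).
  have m0 : 0 < m by rewrite lt_min divr_gt0//= subr_gt0.
  have md : m <= d / 2 by rewrite ge_min lexx.
  have mb : m <= b - a by rewrite ge_min lexx orbT.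
  exists (x - m); split; first by rewrite -subr_eq0 addrAC subrr add0r ?oppr_eq0 gt_eqF.
    by rewrite /= in_itv /=; apply/andP; split; lra.
  by apply: dU; rewrite /ball /= ltr_norml; apply/andP; split; lra.
Qed.

Lemma within_dnbhs_proper A x : limit_point A x -> ProperFilter (within A x^').
Proof.
move=> lA; apply: Build_ProperFilter_ex => P /lA[y [yx Ay]] /(_ yx Ay) Py.
by exists y.
Qed.

Lemma derivable_inP A f x :
  derivable_in A f x -> has_deriv_in A f x (deriv_in A f x).
Proof. by []. Qed.

Lemma has_deriv_in_eq A f x l :
  limit_point A x -> has_deriv_in A f x l -> deriv_in A f x = l.
Proof. by move=> /within_dnbhs_proper pA; exact: cvg_lim. Qed.

Lemma has_deriv_in_unique A f x l m : limit_point A x ->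
  has_deriv_in A f x l -> has_deriv_in A f x m -> l = m.
Proof. by move=> lA /(has_deriv_in_eq lA) <- /(has_deriv_in_eq lA). Qed.

Lemma has_deriv_in_subset A B f x l :
  B `<=` A -> has_deriv_in A f x l -> has_deriv_in B f x l.
Proof.
move=> BA /has_deriv_inP h; apply/has_deriv_inP => e /h[d d0 hd].
by exists d => // y /BA; exact: hd.
Qed.

Lemma has_deriv_in_ext A f g x l : A x -> {in A, f =1 g} ->
  has_deriv_in A f x l -> has_deriv_in A g x l.
Proof.
move=> Ax fg /has_deriv_inP h; apply/has_deriv_inP => e /h[d d0 hd].
by exists d => // y Ay /(hd _ Ay); rewrite !fg// inE.
Qed.

Lemma has_deriv_in_affine A (a b x : R) :
  has_deriv_in A (fun y => a * y + b) x a.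
Proof.
apply/has_deriv_inP => e e0; exists 1 => // y Ay _.
by rewrite (_ : _ - _ = 0) ?normr0 ?mulr_ge0 ?(ltW e0)//; ring.
Qed.

Lemma has_deriv_in_lipschitz A f x l : has_deriv_in A f x l ->
  exists2 d, 0 < d &
    forall y, A y -> `|y - x| < d -> `|f y - f x| <= (`|l| + 1) * `|y - x|.
Proof.
move=> /has_deriv_inP /(_ 1 ltr01)[d d0 hd]; exists d => // y Ay /(hd _ Ay) h.
rewrite (_ : f y - f x = (f y - f x - l * (y - x)) + l * (y - x)); last by ring.
by rewrite (le_trans (ler_normD _ _))// normrM mulrDl addrC lerD2l.
Qed.

Lemma has_deriv_in_comp A B f g x l m :
  (forall y, A y -> B (f y)) -> A x ->
  has_deriv_in A f x l -> has_deriv_in B g (f x) m ->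
  has_deriv_in A (g \o f) x (m * l).
Proof.
move=> AB Ax fl /has_deriv_inP gm; apply/has_deriv_inP => e e0.
have [d1 d10 lip] := has_deriv_in_lipschitz fl.
have K0 : 0 < `|l| + 1 by rewrite ltr_wpDl.
have M0 : 0 < `|m| + 1 by rewrite ltr_wpDl.
have [d2 d20 hg] := gm (e / 2 / (`|l| + 1)) ltac:(by rewrite !divr_gt0).
have /has_deriv_inP /(_ (e / 2 / (`|m| + 1)))[|d3 d30 hf] := fl.
  by rewrite !divr_gt0.
exists (Num.min d1 (Num.min d3 (d2 / (`|l| + 1)))).
  by rewrite !lt_min d10 d30 divr_gt0.
move=> y Ay; rewrite !lt_min => /and3P[y1 y3 y2].
have fyx : `|f y - f x| <= (`|l| + 1) * `|y - x| by exact: lip.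
have fd2 : `|f y - f x| < d2.
  by rewrite (le_lt_trans fyx)// mulrC -ltr_pdivlMr.
have hg' := hg _ (AB _ Ay) fd2; have hf' := hf _ Ay y3.
rewrite /= (_ : _ - _ = (g (f y) - g (f x) - m * (f y - f x)) +
  m * (f y - f x - l * (y - x))); last by ring.
rewrite (le_trans (ler_normD _ _))// normrM.
have -> : e * `|y - x| = e / 2 / (`|l| + 1) * ((`|l| + 1) * `|y - x|) +
   (`|m| + 1) * (e / 2 / (`|m| + 1) * `|y - x|).
  by field; rewrite !gt_eqF.
apply: lerD.
  by rewrite (le_trans hg')// ler_wpM2l// !divr_ge0 ?(ltW e0) ?(ltW K0).
by rewrite ler_pM// lerDl.
Qed.

Lemma has_deriv_in_lincomb A f g x l m c :
  has_deriv_in A f x l -> has_deriv_in A g x m ->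
  has_deriv_in A (fun y => f y - c * g y) x (l - c * m).
Proof.
move=> /has_deriv_inP hf /has_deriv_inP hg; apply/has_deriv_inP => e e0.
have c0 : 0 < `|c| + 1 by rewrite ltr_wpDl.
have [d d0 {}hf] := hf (e / 2) ltac:(by rewrite divr_gt0).
have [d' d'0 {}hg] := hg (e / 2 / (`|c| + 1)) ltac:(by rewrite !divr_gt0).
exists (Num.min d d') => [|y Ay]; first by rewrite lt_min d0.
rewrite lt_min => /andP[/(hf _ Ay) yf /(hg _ Ay) yg].
rewrite (_ : _ - _ = (f y - f x - l * (y - x)) -
  c * (g y - g x - m * (y - x))); last by ring.
rewrite (le_trans (ler_normB _ _))// normrM.
have -> : e * `|y - x| = e / 2 * `|y - x| +
    (`|c| + 1) * (e / 2 / (`|c| + 1) * `|y - x|).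
  by field; rewrite gt_eqF.
by rewrite lerD// ler_pM// lerDl.
Qed.

(** The inverse is assumed Lipschitz, which turns an error small relative to
    the increment of [g] into one small relative to the increment of its
    argument. *)
Lemma has_deriv_in_inverse A B f g x l K :
  (forall y, B y -> A (g y)) -> {in B, cancel g f} -> B x ->
  (forall y, B y -> `|g y - g x| <= K * `|y - x|) -> l != 0 ->
  has_deriv_in A f (g x) l -> has_deriv_in B g x l^-1.
Proof.
move=> BA gK Bx lip l0 /has_deriv_inP hf; apply/has_deriv_inP => e e0.
have K0 : 0 < `|K| + 1 by rewrite ltr_wpDl.
have nl0 : 0 < `|l| by rewrite normr_gt0.
have {}lip y : B y -> `|g y - g x| <= (`|K| + 1) * `|y - x|.
  move=> /lip /le_trans -> //.
  by rewrite ler_wpM2r// (le_trans (ler_norm _))// lerDl.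
have [d d0 {}hf] := hf (e * `|l| / (`|K| + 1))
  ltac:(by rewrite !divr_gt0// mulr_gt0).
exists (d / (`|K| + 1)) => [|y By yx]; first by rewrite divr_gt0.
have gyx : `|g y - g x| < d.
  by rewrite (le_lt_trans (lip _ By))// mulrC -ltr_pdivlMr.
have := hf _ (BA _ By) gyx; rewrite !gK ?inE// => h.
rewrite (_ : _ - _ = - (l^-1 * (y - x - l * (g y - g x)))); last first.
  by field.
rewrite normrN normrM normrV ?unitfE// ler_pdivrMl//.
apply: (le_trans h).
have -> : `|l| * (e * `|y - x|) =
    e * `|l| / (`|K| + 1) * ((`|K| + 1) * `|y - x|).
  by field; rewrite gt_eqF.
by rewrite ler_wpM2l// ?lip// !mulr_ge0// ?(ltW e0)// invr_ge0 ltW.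
Qed.

Lemma is_derive_has_deriv_in A f x l :
  is_derive x 1 f l -> has_deriv_in A f x l.
Proof.
move=> [df <-]; apply/has_deriv_inP => e e0.
have : h^-1 *: ((f \o shift x) (h *: 1) - f x) @[h --> 0^'] --> 'D_1 f x by [].
move=> /cvgrPdist_le /(_ e e0) /nbhs_ballP[d /= d0 hd]; exists d => // y Ay yd.
have [->|yx] := eqVneq y x; first by rewrite !subrr mulr0 subr0 normr0 mulr0.
have yx0 : y - x != 0 by rewrite subr_eq0.
have /= := hd (y - x); rewrite /ball /= sub0r normrN => /(_ yd yx0).
rewrite /GRing.scale /= mulr1 subrK.
rewrite -(@ler_pM2r _ `|y - x|) ?normr_gt0// -normrM mulrBl mulrAC mulVf//.
by rewrite mul1r distrC.
Qed.

Lemma has_deriv_in_is_derive (a b : R) f x l :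
  a < x < b -> has_deriv_in `[a, b] f x l -> is_derive x 1 f l.
Proof.
move=> /andP[ax xb] /has_deriv_inP h.
suff : h^-1 *: ((f \o shift x) (h *: 1) - f x) @[h --> 0^'] --> l.
  move=> lim; apply: DeriveDef; first by apply/cvg_ex; exists l.
  exact: cvg_lim lim.
apply/cvgrPdist_le => e /h[d d0 hd]; apply/nbhs_ballP.
exists (Num.min d (Num.min (x - a) (b - x))).
  by rewrite /= !lt_min d0 !subr_gt0 ax.
move=> y; rewrite /ball /= sub0r normrN !lt_min => /and3P[yd ya yb] y0.
rewrite /GRing.scale /= mulr1.
have Ayx : `[a, b]%classic (y + x).
  move: ya yb; rewrite !ltr_norml => /andP[? ?] /andP[? ?].
  by rewrite /= in_itv /=; apply/andP; split; lra.
have := hd (y + x) Ayx; rewrite addrK => /(_ yd) h'.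
rewrite -(@ler_pM2r _ `|y|) ?normr_gt0// -normrM.
rewrite (_ : _ * y = l * y - (f (y + x) - f x)); last by field.
by rewrite distrC.
Qed.

(** A derivative within [[a, b]] is two-sided in the interior only; at the end
    points it still gives the continuity that the mean value theorem needs. *)
Lemma has_deriv_in_MVT (a b : R) f (df : R -> R) : a < b ->
  (forall x, a <= x <= b -> has_deriv_in `[a, b] f x (df x)) ->
  exists2 c, a <= c <= b & f b - f a = df c * (b - a).
Proof.
move=> ab fdf; have [] := @MVT _ f df a b ab.
- move=> x; rewrite in_itv /= => axb.
  apply: (has_deriv_in_is_derive axb); apply: fdf.
  by case/andP : axb => /ltW -> /ltW ->.
- apply/subspace_continuousP => x; rewrite /= in_itv /= => axb.
  apply/cvgrPdist_le => e e0.
  have [d d0 hd] := has_deriv_in_lipschitz (fdf _ axb).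
  have K0 : 0 < `|df x| + 1 by rewrite ltr_wpDl.
  apply/nbhs_ballP; exists (Num.min d (e / (`|df x| + 1))).
    by rewrite /= lt_min d0 divr_gt0.
  move=> y; rewrite /ball /= lt_min distrC => /andP[yd ye] Ay.
  rewrite distrC (le_trans (hd _ Ay yd))//.
  by rewrite mulrC -ler_pdivlMr// ltW.
- move=> c; rewrite in_itv /= => /andP[/ltW ac /ltW cb] ->.
  by exists c => //; rewrite ac.
Qed.

Lemma holder_in_continuous (a : R) A f :
  0 < a -> holder_in a A f -> {within A, continuous f}.
Proof.
move=> a0 [C hC]; apply/subspace_continuousP => x Ax.
apply/cvgrPdist_le => e e0.
have K0 : 0 < `|C| + 1 by rewrite ltr_wpDl.
apply/nbhs_ballP; exists ((e / (`|C| + 1)) `^ a^-1).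
  by rewrite /= powR_gt0// divr_gt0.
move=> y; rewrite /ball /= => xy Ay; apply: (le_trans (hC _ _ Ax Ay)).
rewrite (@le_trans _ _ ((`|C| + 1) * `|x - y| `^ a))//.
  by rewrite ler_wpM2r ?powR_ge0// (le_trans (ler_norm _))// lerDl.
rewrite mulrC -ler_pdivlMr//.
have -> : e / (`|C| + 1) = ((e / (`|C| + 1)) `^ a^-1) `^ a.
  by rewrite -powRrM mulVf ?gt_eqF// powRr1// divr_ge0// ltW.
by rewrite ge0_ler_powR ?nnegrE ?powR_ge0// ltW.
Qed.

Lemma holder_in_cst (a c : R) A : holder_in a A (fun=> c).
Proof. by exists 0 => x y _ _; rewrite subrr normr0 mul0r. Qed.

Lemma C1holder_inI (a : R) A f (df : R -> R) : 0 < a ->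
  A `<=` limit_point A -> (forall x, A x -> has_deriv_in A f x (df x)) ->
  holder_in a A df -> C1holder_in a A f.
Proof.
move=> a0 lA fdf [C hC].
have dE x : A x -> deriv_in A f x = df x.
  by move=> Ax; apply: has_deriv_in_eq (fdf _ Ax); exact: lA.
have hd : holder_in a A (deriv_in A f).
  by exists C => x y Ax Ay; rewrite !dE//; exact: hC.
split=> //; split; last exact: holder_in_continuous hd.
by move=> x Ax; apply/cvg_ex; exists (df x); exact: fdf.
Qed.

End DerivativeWithinASet.

(** * Primitives and charts of the unit interval *)

Section UnitInterval.
Context {R : realType}.
Implicit Types (f g F L : R -> R) (a x y : R).

Lemma itv01P x : (`[0, 1]%classic x : Prop) <-> 0 <= x <= 1.
Proof. by rewrite /= in_itv. Qed.

Lemma limit_point_itv01 :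
  `[0, 1]%classic `<=` limit_point (`[0, 1]%classic : set R).
Proof. by move=> x /itv01P; apply: limit_point_itvcc; exact: ltr01. Qed.

Lemma has_deriv_in_increment f (df : R -> R) (lo hi : R) :
  (forall x, 0 <= x <= 1 -> has_deriv_in `[0, 1] f x (df x)) ->
  (forall x, 0 <= x <= 1 -> lo <= df x <= hi) ->
  forall x y, 0 <= x -> x <= y -> y <= 1 ->
    lo * (y - x) <= f y - f x <= hi * (y - x).
Proof.
move=> fdf bnd x y x0; rewrite le_eqVlt => /predU1P[<- _|xy y1].
  by rewrite !subrr !mulr0 lexx.
have [z|c /andP[xc cy] ->] := @has_deriv_in_MVT _ x y f df xy.
  move=> /andP[xz zy]; apply: (@has_deriv_in_subset _ `[0, 1]); last first.
    by apply: fdf; rewrite (le_trans x0 xz) (le_trans zy y1).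
  by move=> t /=; rewrite !in_itv /= => /andP[xt ty];
    rewrite (le_trans x0 xt) (le_trans ty y1).
have /andP[? ?] : lo <= df c <= hi.
  by apply: bnd; rewrite (le_trans x0 xc) (le_trans cy y1).
by rewrite !ler_pM2r ?subr_gt0//; apply/andP.
Qed.

Lemma has_deriv_in_distance f (df : R -> R) (hi : R) :
  (forall x, 0 <= x <= 1 -> has_deriv_in `[0, 1] f x (df x)) ->
  (forall x, 0 <= x <= 1 -> 0 <= df x <= hi) ->
  forall x y, 0 <= x <= 1 -> 0 <= y <= 1 -> `|f x - f y| <= hi * `|x - y|.
Proof.
move=> fdf bnd x y; wlog xy : x y / x <= y.
  move=> wl xx yy; have [xy|/ltW yx] := leP x y; first exact: wl.
  by rewrite distrC (distrC x); exact: wl.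
move=> /andP[x0 _] /andP[_ y1].
have := has_deriv_in_increment fdf bnd x0 xy y1; rewrite mul0r => /andP[h1 h2].
by rewrite distrC (distrC x) !ger0_norm// subr_ge0.
Qed.

Lemma has_deriv_in_eq0_const f :
  (forall x, 0 <= x <= 1 -> has_deriv_in `[0, 1] f x 0) ->
  forall x, 0 <= x <= 1 -> f x = f 0.
Proof.
move=> f0 x /andP[x0 x1].
have := @has_deriv_in_increment f (fun=> 0) 0 0 f0
  (fun _ _ => ltac:(by rewrite lexx)) 0 x (lexx _) x0 x1.
by rewrite !mul0r -eq_le => /eqP/esym/eqP; rewrite subr_eq0 => /eqP.
Qed.

(** Composing with the retraction onto [[0, 1]] extends a function that is
    continuous on the interval to one that is continuous on the line, where the
    fundamental theorem of calculus gives two-sided derivatives. *)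
Definition clamp x : R := Num.max 0 (Num.min x 1).

Lemma clamp_itv x : 0 <= clamp x <= 1.
Proof. by rewrite /clamp le_max lexx /= ge_max ler01 ge_min lexx orbT. Qed.

Lemma clamp_id x : 0 <= x <= 1 -> clamp x = x.
Proof. by move=> /andP[x0 x1]; rewrite /clamp min_l// max_r. Qed.

Lemma clamp_dist x y : `|clamp x - clamp y| <= `|x - y|.
Proof.
wlog xy : x y / x <= y.
  move=> wl; have [/wl//|/ltW/wl] := leP x y.
  by rewrite distrC (distrC x).
rewrite (distrC x) (ger0_norm (_ : 0 <= y - x)) ?subr_ge0//.
rewrite /clamp /Num.max /Num.min ler_norml.
by do !case: ifPn; rewrite -?leNgt => *; apply/andP; split; lra.
Qed.

Lemma continuous_comp_clamp f :
  {within `[0, 1], continuous f} -> continuous (f \o clamp).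
Proof.
move=> /subspace_continuousP cf x; apply/cvgrPdist_le => e e0.
have /cvgrPdist_le/(_ e e0)/nbhs_ballP[d /= d0 hd] :=
  cf (clamp x) ((itv01P _).2 (clamp_itv x)).
apply/nbhs_ballP; exists d => // y xy; apply: hd; last first.
  exact/itv01P/clamp_itv.
exact: le_lt_trans (clamp_dist _ _) xy.
Qed.

Lemma continuous_antiderivative f : continuous f ->
  exists F, forall x, 0 <= x <= 1 -> has_deriv_in `[0, 1] F x (f x).
Proof.
(* Integrating from [-1] makes every point of [[0, 1]], including 0, interior
   to the domain on which the integral can be differentiated. *)
move=> cf; exists (fun x => \int[lebesgue_measure]_(t in `[-1, x]) f t)%R.
move=> x /andP[x0 x1]; apply: is_derive_has_deriv_in.
have [] := @continuous_FTC1 R f (BLeft (-1)) x 2 _ _ _ (cf x).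
- lra.
- apply: continuous_compact_integrable; first exact: segment_compact.
  exact: continuous_subspaceT.
- by rewrite ?bnd_simp ?lte_fin; lra.
- by move=> dF F'; apply: (DeriveDef dF); rewrite -derive1E; exact: F'.
Qed.

Lemma holder_in_bounded a L : 0 <= a -> holder_in a `[0, 1] L ->
  exists K, forall x, 0 <= x <= 1 -> `|L x| <= K.
Proof.
move=> a0 [C hC]; exists (`|C| + `|L 0|) => x x01.
rewrite -(subrK (L 0) (L x)).
rewrite (le_trans (ler_normD _ _))// lerD2r.
have /itv01P x01' := x01.
have /(le_trans (hC _ _ x01' _)) -> // : C * `|x - 0| `^ a <= `|C|.
  rewrite (le_trans (ler_wpM2r _ (ler_norm _)))// ?powR_ge0//.
  rewrite ler_piMr// subr0.
  case/andP : x01 => x0 x1; rewrite ger0_norm//.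
  have -> : 1 = 1 `^ a :> R by rewrite powR1.
  by rewrite ge0_ler_powR// nnegrE.
by apply/itv01P; rewrite lexx ler01.
Qed.

Lemma expR_dist (u v K : R) : `|u| <= K -> `|v| <= K ->
  `|expR u - expR v| <= expR K * `|u - v|.
Proof.
wlog uv : u v / u <= v.
  move=> wl uK vK; have [uv|/ltW vu] := leP u v; first exact: wl.
  by rewrite distrC (distrC u); exact: wl.
move=> uK vK; rewrite distrC (distrC u) !ger0_norm ?subr_ge0 ?ler_expR//.
have -> : expR v - expR u = expR v * (1 - expR (u - v)).
  by rewrite mulrBr mulr1 [expR v * _]mulrC -expRD subrK.
have h1 := expR_ge1Dx (u - v).
rewrite ler_pM ?expR_ge0// ?ler_expR ?(le_trans (ler_norm v))//; last lra.
by rewrite subr_ge0 -expR0 ler_expR subr_le0.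
Qed.

Lemma holder_in_expR a (s : R) L : 0 <= a -> holder_in a `[0, 1] L ->
  holder_in a `[0, 1] (fun x => expR (s * L x)).
Proof.
move=> a0 hL; have [K LK] := holder_in_bounded a0 hL.
have [C hC] := hL.
exists (expR (`|s| * K) * (`|s| * C)) => x y x01 y01.
have bd z : `[0, 1]%classic z -> `|s * L z| <= `|s| * K.
  by move=> /itv01P /LK h; rewrite normrM ler_wpM2l.
rewrite (le_trans (expR_dist (bd _ x01) (bd _ y01)))//.
rewrite -mulrA ler_wpM2l ?expR_ge0// -mulrBr normrM -mulrA ler_wpM2l//.
exact: hC.
Qed.

Lemma holder_in_comp_lipschitz a L g (K : R) : 0 <= a -> 0 <= K ->
  (forall x, 0 <= x <= 1 -> 0 <= g x <= 1) ->
  (forall x y, 0 <= x <= 1 -> 0 <= y <= 1 -> `|g x - g y| <= K * `|x - y|) ->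
  holder_in a `[0, 1] L -> holder_in a `[0, 1] (L \o g).
Proof.
move=> a0 K0 g01 lip [C hC]; exists (`|C| * K `^ a) => x y /itv01P x01 /itv01P y01.
rewrite (le_trans (hC _ _ _ _))//; do ?exact/itv01P/g01.
rewrite -mulrA -powRM//.
rewrite (le_trans (ler_wpM2r _ (ler_norm C)))// ?powR_ge0// ler_wpM2l//.
by rewrite ge0_ler_powR ?nnegrE ?mulr_ge0// lip.
Qed.

(** Only coboundaries [L \o f - L] matter later on, and they do not see the
    constant [k], which is therefore free to be used for the normalisation
    [F 1 = 1]. *)
Lemma normalised_antiderivative a L : 0 < a -> holder_in a `[0, 1] L ->
  exists k F, [/\ F 0 = 0, F 1 = 1 &
    forall x, 0 <= x <= 1 -> has_deriv_in `[0, 1] F x (expR (- (L x + k)))].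
Proof.
move=> a0 hL; have [K LK] := holder_in_bounded (ltW a0) hL.
have cL : continuous (fun x => expR (- L (clamp x))).
  move=> x; apply: (@continuous_comp _ _ _ (fun x => - L (clamp x)) expR).
    apply: (@continuousN _ _ _ (L \o clamp)).
    exact/continuous_comp_clamp/(holder_in_continuous a0).
  exact: continuous_expR.
have [F dF] := continuous_antiderivative cL.
have {}dF x : 0 <= x <= 1 -> has_deriv_in `[0, 1] F x (expR (- L x)).
  by move=> x01; have := dF _ x01; rewrite clamp_id.
have Z0 : 0 < F 1 - F 0.
  have bnd x : 0 <= x <= 1 -> expR (- K) <= expR (- L x) <= expR K.
    by move=> /LK; rewrite ler_norml !ler_expR => /andP[? ?]; apply/andP; split; lra.
  have /andP[h _] := has_deriv_in_increment dF bnd (lexx 0) ler01 (lexx 1).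
  by rewrite (lt_le_trans _ h)// subr0 mulr1 expR_gt0.
set Z := F 1 - F 0 in Z0.
exists (ln Z), (fun x => Z^-1 * F x + (- (Z^-1 * F 0))).
split=> [||x x01]; first by rewrite subrr.
  by rewrite -mulrBr mulVf// gt_eqF.
have -> : expR (- (L x + ln Z)) = Z^-1 * expR (- L x).
  by rewrite opprD expRD mulrC (expRN (ln Z)) lnK.
apply: (@has_deriv_in_comp _ _ setT F (fun y => Z^-1 * y + - (Z^-1 * F 0))) => //.
- exact: dF.
- exact: has_deriv_in_affine.
Qed.

End UnitInterval.

Section Chart.
Context {R : realType}.
Variables (a : R) (L F : R -> R).
Hypotheses (a0 : 0 < a) (hL : holder_in a `[0, 1] L) (F0 : F 0 = 0) (F1 : F 1 = 1).
Hypothesis dF :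
  forall x, 0 <= x <= 1 -> has_deriv_in `[0, 1] F x (expR (- L x)).

(** [L] is bounded, so [expR (- L)] is bounded away from 0.  This makes [F]
    injective and its inverse Lipschitz. *)
Lemma chart_expanding : exists2 m, 0 < m &
  forall x y, 0 <= x -> x <= y -> y <= 1 -> m * (y - x) <= F y - F x.
Proof.
have [K LK] := holder_in_bounded (ltW a0) hL.
exists (expR (- K)) => [|x y x0 xy y1]; first exact: expR_gt0.
have bnd z : 0 <= z <= 1 -> expR (- K) <= expR (- L z) <= expR K.
  by move=> /LK; rewrite ler_norml !ler_expR => /andP[? ?]; apply/andP; split; lra.
by have /andP[] := has_deriv_in_increment dF bnd x0 xy y1.
Qed.

Lemma chart_mono x y : 0 <= x -> x < y -> y <= 1 -> F x < F y.
Proof.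
move=> x0 xy y1; have [m m0 /(_ x y x0 (ltW xy) y1) h] := chart_expanding.
by rewrite -subr_gt0 (lt_le_trans _ h)// mulr_gt0// subr_gt0.
Qed.

Lemma chart_itv x : 0 <= x <= 1 -> 0 <= F x <= 1.
Proof.
move=> /andP[x0 x1]; rewrite -{1}F0 -F1; apply/andP; split.
  by move: x0; rewrite le_eqVlt => /predU1P[<-//|x0]; rewrite ltW// chart_mono.
by move: x1; rewrite le_eqVlt => /predU1P[->//|x1]; rewrite ltW// chart_mono.
Qed.

Lemma chart_bij : set_bij `[0, 1] `[0, 1] F.
Proof.
have [K LK] := holder_in_bounded (ltW a0) hL.
split.
- by move=> x /itv01P /chart_itv /itv01P.
- move=> x y /set_mem/itv01P /andP[x0 x1] /set_mem/itv01P/andP[y0 y1] Fxy.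
  have [xy|yx|//] := ltgtP x y.
    by have := chart_mono x0 xy y1; rewrite Fxy ltxx.
  by have := chart_mono y0 yx x1; rewrite Fxy ltxx.
- move=> y /itv01P y01.
  have [||c c01 <-] := @IVT R F 0 1 y ler01.
  + apply: (@holder_in_continuous _ 1) => //.
    exists (expR K) => u v /itv01P u01 /itv01P v01; rewrite powRr1//.
    apply: (has_deriv_in_distance dF) => // x /LK.
    by rewrite ler_norml ler_expR expR_ge0 => /andP[? _]; lra.
  + by rewrite F0 F1 min_l// max_r.
  + by exists c.
Qed.

Let G := inverse_on `[0, 1] F.

Lemma chart_inverse_bij : set_bij `[0, 1] `[0, 1] G.
Proof. exact: bijpinv_bij chart_bij. Qed.

Lemma chart_inverse_itv y : 0 <= y <= 1 -> 0 <= G y <= 1.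
Proof. by case: chart_inverse_bij => h _ _ /itv01P /h /itv01P. Qed.

Lemma chart_inverseK y : 0 <= y <= 1 -> F (G y) = y.
Proof.
by move=> /itv01P y01; case: chart_bij => _ _ s; rewrite /G /inverse_on (surjpK _ s) ?inE.
Qed.

Lemma chartK x : 0 <= x <= 1 -> G (F x) = x.
Proof.
by move=> /itv01P x01; case: chart_bij => _ s _; rewrite /G /inverse_on pinvKV ?inE.
Qed.

Lemma inverse_on_chart_inverse x : 0 <= x <= 1 -> inverse_on `[0, 1] G x = F x.
Proof.
move=> x01; rewrite -{1}(chartK x01) /inverse_on pinvKV ?inE//.
  by case: chart_inverse_bij.
exact/itv01P/chart_itv.
Qed.

(** The derivative of the inverse [G] of [F] is [expR (L (G y))], which is
    Holder with the exponent of [L] because [G] is Lipschitz. *)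
Lemma chart_inverse_diffeo : C1holder_diffeo a `[0, 1] `[0, 1] G.
Proof.
have [m m0 hm] := chart_expanding.
have lip x y : 0 <= x <= 1 -> 0 <= y <= 1 -> `|G x - G y| <= m^-1 * `|x - y|.
  move=> x01 y01.
  rewrite -{2}(chart_inverseK x01) -{2}(chart_inverseK y01) ler_pdivlMl//.
  move: (G x) (G y) (chart_inverse_itv x01) (chart_inverse_itv y01) => u v.
  wlog uv : u v / u <= v.
    move=> wl uu vv; have [uv|/ltW vu] := leP u v; first exact: wl.
    by rewrite distrC (distrC (F u)); exact: wl.
  move=> /andP[u0 _] /andP[_ v1]; have h := hm _ _ u0 uv v1.
  rewrite distrC (distrC (F u)) !ger0_norm ?subr_ge0//.
  by rewrite -subr_ge0 (le_trans _ h)// mulr_ge0 ?subr_ge0// ltW.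
split; first exact: chart_inverse_bij.
- apply: (@C1holder_inI _ _ _ _ (fun y => expR (1 * (L \o G) y))) => //.
  + exact: limit_point_itv01.
  + move=> y /[dup] y01' /itv01P y01; rewrite mul1r -[expR _]invrK -expRN.
    apply: (@has_deriv_in_inverse _ `[0, 1] _ F _ _ _ m^-1) => //.
    * by move=> z /itv01P /chart_inverse_itv /itv01P.
    * by move=> z /set_mem/itv01P /chart_inverseK.
    * by move=> z /itv01P z01; exact: lip.
    * by rewrite gt_eqF ?expR_gt0.
    * exact/dF/chart_inverse_itv.
  + apply: holder_in_expR; first exact: ltW.
    apply: (holder_in_comp_lipschitz _ _ chart_inverse_itv lip) hL.
      exact: ltW.
    by rewrite invr_ge0 ltW.
- apply: (@C1holder_inI _ _ _ _ (fun y => expR (-1 * L y))) => //.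
  + exact: limit_point_itv01.
  + move=> x /[dup] x01' /itv01P x01; rewrite mulN1r.
    apply: has_deriv_in_ext (dF x01) => // z /set_mem/itv01P z01.
    by rewrite inverse_on_chart_inverse.
  + by apply: holder_in_expR => //; exact: ltW.
Qed.

End Chart.

(** * Covering by the branches, and codings *)

Section HalfOpenIntervals.
Context {R : realType} {I : finType}.
Implicit Types (l u : I -> R).

Local Notation Ico l u i := (`[l i, u i[%classic : set R).

Lemma measure_bigcup_Ico l u :
  (forall i j, i != j -> Ico l u i `&` Ico l u j = set0) ->
  lebesgue_measure (\bigcup_i Ico l u i) =
  (\sum_(i : I) lebesgue_measure (Ico l u i))%E.
Proof.
move=> dis; rewrite (@measure_fin_bigcup _ _ _ lebesgue_measure I setT)//.
- rewrite [RHS]fsbig_seq ?index_enum_uniq//.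
  suff -> : [set: I] = [set` index_enum I] by [].
  by apply/seteqP; split=> i //= _; rewrite mem_index_enum.
- exact: finite_finset.
- by apply/trivIsetP => i j _ _; exact: dis.
Qed.

(** If a point [s] of [[0, 1[] were missed, then, the intervals being finitely
    many and closed on the left, so would be some [[s, s + e[]; together with
    the intervals it would have measure [1 + e] inside [[0, 1[]. *)
Lemma full_measure_Ico_cover l u :
  (forall i, 0 <= l i /\ u i <= 1) ->
  (forall i j, i != j -> Ico l u i `&` Ico l u j = set0) ->
  (\sum_(i : I) lebesgue_measure (Ico l u i) = 1)%E ->
  forall s : R, 0 <= s < 1 -> exists i, l i <= s < u i.
Proof.
move=> lu01 dis full s /andP[s0 s1]; apply: contrapT => /forallNP nos.
have : \forall e \near 0^'+, forall i, Ico l u i `&` `[s, s + e[ = set0.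
  apply: filter_forall => i.
  have /negP := nos i; rewrite negb_and -!ltNge -leNgt => /orP[sl|us].
  - near=> e; apply/seteqP; split=> // t [] /=; rewrite !in_itv /=.
    move=> /andP[lt _] /andP[_ te].
    have el : e < l i - s by near: e; apply: nbhs_right_lt; rewrite subr_gt0.
    by clear full; lra.
  - near=> e; apply/seteqP; split=> // t [] /=; rewrite !in_itv /=.
    by move=> /andP[_ tu] /andP[st _]; clear full; lra.
move=> near_dis.
near (0 : R)^'+ => e.
have e0 : 0 < e by near: e; exact: nbhs_right_gt.
have es : e < 1 - s by near: e; apply: nbhs_right_lt; rewrite subr_gt0.
have dise : forall i, Ico l u i `&` `[s, s + e[ = set0 by near: e.
have mU : measurable (\bigcup_i Ico l u i).
  by apply: fin_bigcup_measurable => // i _; exact: measurable_itv.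
have sub1 : \bigcup_i Ico l u i `|` `[s, s + e[ `<=` `[0, 1[.
  move=> t [[i _]|] /=; rewrite !in_itv /= => /andP[? ?].
    by have [? ?] := lu01 i; clear full; apply/andP; split; lra.
  by clear full; apply/andP; split; lra.
have : (lebesgue_measure (\bigcup_i Ico l u i) +
        lebesgue_measure (`[s, (s + e)%R[%classic : set R) <=
        lebesgue_measure (`[0%R, 1%R[%classic : set R))%E.
  rewrite -measureU//; last by rewrite setI_bigcupl bigcup0.
  apply: le_measure; rewrite ?inE//.
  by apply: measurableU => //; exact: measurable_itv.
rewrite measure_bigcup_Ico// full !lebesgue_measure_itv /=.
rewrite !lte_fin ltr01 ltrDl e0 -!EFinD lee_fin.
by clear full; lra.
Unshelve. all: by end_near.
Qed.

End HalfOpenIntervals.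

Lemma increasing_image_Ico (R : realType) (f : R -> R) (a b : R) :
  {in `[0, 1] &, {homo f : x y / x < y}} ->
  f @` `[0, 1] = `[a, b]%classic -> a <= b ->
  [/\ a = f 0, b = f 1 & f @` `[0, 1[ = `[f 0, f 1[%classic].
Proof.
move=> fmono img ab.
have fle x y : 0 <= x -> x <= y -> y <= 1 -> f x <= f y.
  move=> x0; rewrite le_eqVlt => /predU1P[->//|xy] y1.
  by rewrite ltW// fmono// in_itv /=; apply/andP; split; lra.
have f0a : a = f 0.
  have [x] : (f @` `[0, 1]) a by rewrite img /= in_itv /= lexx.
  rewrite /= in_itv /= => /andP[x0 x1] fx.
  have : `[a, b]%classic (f 0).
    by rewrite -img; exists 0 => //=; rewrite in_itv /= lexx ler01.
  rewrite /= in_itv /= => /andP[af _].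
  by apply/eqP; rewrite eq_le af -fx fle.
have f1b : b = f 1.
  have [x] : (f @` `[0, 1]) b by rewrite img /= in_itv /= lexx ab.
  rewrite /= in_itv /= => /andP[x0 x1] fx.
  have : `[a, b]%classic (f 1).
    by rewrite -img; exists 1 => //=; rewrite in_itv /= lexx ler01.
  rewrite /= in_itv /= => /andP[_ fb].
  by apply/eqP; rewrite eq_le fb -fx fle.
split=> //; apply/seteqP; split=> [_ [x /= + <-]|y /=]; rewrite !in_itv /=.
  move=> /andP[x0 x1]; rewrite fle ?(ltW x1)//=.
  by rewrite fmono// in_itv /= ?x0 ?(ltW x1) ?ler01 ?lexx.
move=> /andP[fy yf].
have [x] : (f @` `[0, 1]) y by rewrite img /= in_itv /= f0a f1b fy ltW.
rewrite /= in_itv /= => /andP[x0 x1] fx; exists x => //=.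
rewrite in_itv /= x0 lt_neqAle x1 andbT; apply/eqP => x1E.
by move: yf; rewrite -fx x1E ltxx.
Qed.

Section Ifs.
Context {R : realType} {I : finType} (T : I -> R -> R) (P : I -> set R).
Hypothesis gen : generates T P.

Let dT i x := deriv_in `[0, 1] (T i) x.

Lemma ifs_has_deriv i x : 0 <= x <= 1 -> has_deriv_in `[0, 1] (T i) x (dT i x).
Proof.
by case: gen => _ _ _ + _ => /(_ i)[_ [_ [+ _] _] _ _] => + /itv01P; apply.
Qed.

Lemma ifs_deriv_gt0 i x : 0 <= x <= 1 -> 0 < dT i x.
Proof. by case: gen => _ _ _ + _ => /(_ i)[_ _ + _] => + x01; apply. Qed.

Lemma ifs_image i : 0 <= T i 0 /\ T i 1 <= 1 /\
  T i @` `[0, 1] = `[T i 0, T i 1]%classic /\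
  T i @` `[0, 1[ = `[T i 0, T i 1[%classic.
Proof.
case: gen => [[_ /(_ i)[a [b [a0 ab b1 img]]]] _ _ /(_ i)[mono _ _ _] _].
by have [<- <- ->] := increasing_image_Ico mono img ab.
Qed.

Lemma ifs_itv i x : 0 <= x <= 1 -> 0 <= T i x <= 1.
Proof.
move=> /itv01P x01; have [a0 [b1 [img _]]] := ifs_image i.
have : (T i @` `[0, 1]) (T i x) by exists x.
by rewrite img /= in_itv /= => /andP[? ?]; apply/andP; split; lra.
Qed.

Lemma ifs_mono i x y : 0 <= x -> x < y -> y <= 1 -> T i x < T i y.
Proof.
case: gen => _ _ _ /(_ i)[mono _ _ _] _ x0 xy y1.
by apply: mono; rewrite // in_itv /=; apply/andP; split; lra.
Qed.

Lemma ifs_contracting : exists2 c : R, 0 < c < 1 &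
  forall i x y, 0 <= x <= 1 -> 0 <= y <= 1 -> `|T i x - T i y| <= c * `|x - y|.
Proof.
case: gen => _ _ _ _ [c c01 hc]; exists c => // i.
apply: (has_deriv_in_distance (@ifs_has_deriv i)) => x x01.
by have /andP[? ?] := hc i x x01; rewrite !ltW.
Qed.

Lemma ifs_cover_Ico s : 0 <= s < 1 -> exists2 i, T i 0 <= s & s < T i 1.
Proof.
move=> s01; case: (gen) => _ dis full _ _.
have imgE i := (ifs_image i).2.2.2.
have [i|i j ij||i /andP[? ?]] := @full_measure_Ico_cover R I (T^~ 0) (T^~ 1) _ _ _ s s01.
- by have [? [? _]] := ifs_image i.
- by rewrite -!imgE; exact: dis.
- by rewrite -full; apply: eq_bigr => i _; rewrite imgE.
- by exists i.
Qed.

(** At [s = 1] the half-open intervals say nothing: there, if no image contained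
    1, all the images would stop at a common distance from it. *)
Lemma ifs_cover s : 0 <= s <= 1 -> exists i, exists2 t, 0 <= t <= 1 & s = T i t.
Proof.
move=> /andP[s0 s1].
suff [i si] : exists i, T i 0 <= s <= T i 1.
  have [_ [_ [img _]]] := ifs_image i.
  have [t /itv01P t01 <-] : (T i @` `[0, 1]) s by rewrite img /= in_itv.
  by exists i, t.
move: s1; rewrite le_eqVlt => /predU1P[->|s1]; last first.
  have [|i ? ?] := @ifs_cover_Ico s; first by rewrite s0.
  by exists i; apply/andP; split => //; exact: ltW.
apply: contrapT => /forallNP no1.
have lt1 i : T i 1 < 1.
  rewrite ltNge; apply/negP => h; apply: (no1 i); rewrite h andbT.
  by have /andP[] := @ifs_itv i 0 ltac:(by rewrite lexx ler01).
have : \forall e \near (0 : R)^'+, forall i, T i 1 < 1 - e.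
  apply: filter_forall => i; near=> e.
  have ei : e < 1 - T i 1 by near: e; apply: nbhs_right_lt; rewrite subr_gt0.
  lra.
move=> near1; near (0 : R)^'+ => e.
have e0 : 0 < e by near: e; exact: nbhs_right_gt.
have e1 : e < 1 by near: e; exact: nbhs_right_lt.
have he : forall i, T i 1 < 1 - e by near: e.
have [|i _] := @ifs_cover_Ico (1 - e); first by apply/andP; split; lra.
by have hei := he i; lra.
Unshelve. all: by end_near.
Qed.

Lemma ln_dist_ge1 (u v : R) : 1 <= u -> 1 <= v -> `|ln u - ln v| <= `|u - v|.
Proof.
wlog vu : u v / v <= u.
  move=> wl u1 v1; have [vu|/ltW uv] := leP v u; first exact: wl.
  by rewrite distrC (distrC u); exact: wl.
move=> u1 v1; have v0 : 0 < v by lra. have u0 : 0 < u by lra.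
rewrite !ger0_norm ?subr_ge0 ?ler_ln ?posrE//.
rewrite -ln_div ?posrE//.
have -> : u / v = 1 + (u - v) / v by field; rewrite gt_eqF.
apply: (@le_trans _ _ ((u - v) / v)).
  by apply: le_ln1Dx; rewrite (@lt_le_trans _ _ 0)// divr_ge0 ?subr_ge0// ltW.
by rewrite ler_pdivrMr// ler_peMr// subr_ge0.
Qed.

(** The Holder condition is imposed on the inverse branches.  It passes to
    [ln \o dT i] because the derivative of the inverse branch at [T i x] is
    [(dT i x)^-1], which is at least 1, and [ln] is 1-Lipschitz there. *)
Lemma ifs_ln_deriv_holder i : exists2 a : R, 0 < a < 1 &
  holder_in a `[0, 1] (fun x => ln (dT i x)).
Proof.
case: (gen) => _ _ _ /(_ i)[mono bij _ [a a01 [[Sd _] [C hC]]]] [c /andP[c0 c1] hc].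
exists a => //.
set B := T i @` `[0, 1] in Sd hC; set S := inverse_on `[0, 1] (T i) in Sd hC.
have BT x : 0 <= x <= 1 -> B (T i x) by move=> /itv01P x01; exists x.
have SK x : 0 <= x <= 1 -> S (T i x) = x.
  move=> /itv01P x01; rewrite /S /inverse_on pinvKV ?inE//.
  by case: bij => [[]].
have dS x : 0 <= x <= 1 -> deriv_in B S (T i x) = (dT i x)^-1.
  move=> x01; have dT0 := ifs_deriv_gt0 i x01.
  apply: (@mulIf _ (dT i x)); first by rewrite gt_eqF.
  rewrite mulVf ?gt_eqF//.
  apply: (@has_deriv_in_unique _ `[0, 1] (fun y => 1 * y + 0) x).
  - exact/limit_point_itv01/itv01P.
  - apply: (@has_deriv_in_ext _ _ (S \o T i)); first exact/itv01P.
      by move=> y /set_mem/itv01P y01; rewrite /= SK// mul1r addr0.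
    apply: (@has_deriv_in_comp _ _ B) => //.
    + exact: ifs_has_deriv.
    + exact/derivable_inP/Sd/BT.
  - exact: has_deriv_in_affine.
have dS1 x : 0 <= x <= 1 -> 1 <= (dT i x)^-1.
  move=> x01; have /andP[? h] := hc i x x01; rewrite invf_ge1//.
  by rewrite (le_trans (ltW h))// ltW.
exists `|C| => x y /itv01P x01 /itv01P y01.
have lnE t : 0 <= t <= 1 -> ln (dT i t) = - ln (dT i t)^-1.
  by move=> t01; rewrite lnV ?opprK// posrE ifs_deriv_gt0.
rewrite !lnE// -opprD normrN.
rewrite (le_trans (ln_dist_ge1 (dS1 _ x01) (dS1 _ y01)))// -!dS//.
rewrite (le_trans (hC _ _ (BT _ x01) (BT _ y01)))//.
rewrite (le_trans (ler_wpM2r _ (ler_norm C)))// ?powR_ge0// ler_wpM2l//.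
have lip : `|T i x - T i y| <= 1 * `|x - y|.
  apply: (has_deriv_in_distance (@ifs_has_deriv i)) => // t t01.
  have /andP[d0 dc] := hc i t t01.
  by rewrite (ltW d0) (ltW (lt_trans dc c1)).
case/andP : a01 => ? ?; rewrite mul1r in lip.
by rewrite ge0_ler_powR ?nnegrE// ltW.
Qed.

Lemma ifs_inhabited : inhabited I.
Proof.
apply: contrapT => noI; case: (gen) => _ _ + _ _.
rewrite big1 => [/eqP|i _]; last by case: noI; exists.
by rewrite eq_sym onee_eq0.
Qed.

End Ifs.

Section Coding.
Context {R : realType} {I : finType} (T : I -> R -> R) (P : I -> set R).
Hypothesis gen : generates T P.
Implicit Types x y : Sigma I.

Definition scons (i : I) x : Sigma I := fun n => if n is m.+1 then x m else i.

Lemma shift_scons i x : Defs.shift (scons i x) = x.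
Proof. by []. Qed.

(** Describing a coding by an orbit of preimages, rather than by the limit that
    defines [coding], makes it immediate to prefix a letter and to build a code
    of a given point; [codes_coding] recovers the limit. *)
Definition codes x (s : R) : Prop :=
  exists2 orbit : nat -> R, orbit 0%N = s &
    forall n, 0 <= orbit n <= 1 /\ orbit n = T (x n) (orbit n.+1).

Lemma codes_itv x s : codes x s -> 0 <= s <= 1.
Proof. by case=> o <- /(_ 0%N)[]. Qed.

Lemma codes_scons i x s : codes x s -> codes (scons i x) (T i s).
Proof.
move=> xs; have s01 := codes_itv xs; case: xs => o os ho.
exists (fun n => if n is m.+1 then o m else T i s) => // -[|n] /=.
  by rewrite os; split => //; exact: (ifs_itv gen).
exact: ho.
Qed.

Lemma codes_exists s : 0 <= s <= 1 -> exists x, codes x s.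
Proof.
move=> s01; have [i0] := ifs_inhabited gen.
have /choice[step stepP] : forall t : R, exists p : I * R,
    0 <= t <= 1 -> 0 <= p.2 <= 1 /\ t = T p.1 p.2.
  move=> t.
  have [/(ifs_cover gen)[i [u u01 tE]]|nt] := pselect (0 <= t <= 1).
    by exists (i, u).
  by exists (i0, 0).
pose o n := iter n (fun t => (step t).2) s.
have o01 n : 0 <= o n <= 1 by elim: n => [//|n /stepP[]].
by exists (fun n => (step (o n)).1), o => // n; have [_ h] := stepP _ (o01 n).
Qed.

Lemma codes_coding x s : codes x s -> coding T x = s.
Proof.
move=> [q qs hq]; have [c /andP[c0 c1] hc] := ifs_contracting gen.
have fold01 n y : 0 <= foldr T 0 (mkseq y n) <= 1.
  rewrite /mkseq; elim: (iota 0 n) => [|k l IH] /=; first by rewrite lexx ler01.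
  exact: (ifs_itv gen).
have fold_dist n : forall y (p : nat -> R),
    (forall n, 0 <= p n <= 1 /\ p n = T (y n) (p n.+1)) ->
    `|p 0%N - foldr T 0 (mkseq y n)| <= c ^+ n.
  elim: n => [|n IH] y p hp.
    by have [/andP[? ?] _] := hp 0%N; rewrite /= subr0 ger0_norm.
  have -> : mkseq y n.+1 = y 0%N :: mkseq (fun k => y k.+1) n.
    by rewrite /mkseq /= -[1%N]addn0 iotaDl -map_comp.
  rewrite /= (hp 0%N).2 (le_trans (hc _ _ _ _ _))//; first exact: (hp 1%N).1.
  rewrite exprS ler_wpM2l ?(ltW c0)//.
  by apply: (IH (fun k => y k.+1) (fun k => p k.+1)) => k; exact: hp.
apply: cvg_lim => //; apply/cvgrPdist_le => e e0.
have : (c ^+ n @[n --> \oo] --> 0).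
  by apply: cvg_expr; rewrite ger0_norm// ltW.
move=> /cvgrPdist_le/(_ e e0) [N _ hN]; exists N => // n /hN /=.
rewrite sub0r normrN ger0_norm ?exprn_ge0 ?(ltW c0)//; apply: le_trans.
by rewrite -qs; exact: fold_dist.
Qed.

Lemma geometric_potential_scons i x s : codes x s ->
  geometric_potential T (scons i x) = - ln (deriv_in `[0, 1] (T i) s).
Proof. by move=> xs; rewrite /geometric_potential shift_scons (codes_coding xs). Qed.

End Coding.

(** * The transfer function of a lattice potential *)

Section DiscreteSubgroup.
Context {R : realType} (G : set R).
Hypothesis hG : discrete_subgroup G.

Lemma discrete_subgroupN u : G u -> G (- u).
Proof. by case: hG => G0 GB _ Gu; rewrite -sub0r; exact: GB. Qed.

Lemma discrete_subgroupD u v : G u -> G v -> G (u + v).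
Proof.
by case: hG => G0 GB _ Gu Gv; rewrite -[v]opprK; apply/GB/discrete_subgroupN.
Qed.

Lemma discrete_subgroup_sum (w : nat -> R) n :
  (forall k, G (w k)) -> G (\sum_(0 <= k < n) w k).
Proof.
move=> Gw; elim: n => [|n IH]; first by rewrite big_nil; case: hG.
by rewrite big_nat_recr//=; exact: discrete_subgroupD.
Qed.

(** By translation the gap around 0 separates any two points of [G], which is
    how discreteness is used: a convergent sequence in [G] is eventually
    constant, and a continuous function whose increments lie in [G] cannot
    move. *)
Lemma discrete_subgroup_gap : exists2 d, 0 < d & forall u, G u -> `|u| < d -> u = 0.
Proof.
case: hG => G0 _ /(_ 0 G0)[_ [V /nbhs_ballP[d /= d0 dV] VG]].
exists d => // u Gu ud; suff : [set (0 : R)] u by [].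
by rewrite -VG; split => //; apply: dV; rewrite /ball /= sub0r normrN.
Qed.

Lemma discrete_subgroup_cvg (w : nat -> R) (z : R) :
  (forall k, G (w k)) -> w n @[n --> \oo] --> z -> G z.
Proof.
move=> Gw wz; have [d d0 gap] := discrete_subgroup_gap.
have /cvgrPdist_lt/(_ (d / 2))[|N _ hN] := wz; first by rewrite divr_gt0.
have wN n : (N <= n)%N -> w n = w N.
  move=> Nn; apply/eqP; rewrite -subr_eq0; apply/eqP/gap.
    by case: hG => _ GB _; exact: GB.
  rewrite (_ : _ - _ = (z - w N) - (z - w n)); last by ring.
  rewrite (le_lt_trans (ler_normB _ _))// (splitr d) ltrD//.
    exact: (hN N (leqnn _)).
  exact: hN.
suff -> : z = w N by [].
by rewrite -(cvg_lim _ wz)//; apply: lim_near_cst => //; exists N.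
Qed.

Lemma continuous_discrete_const (D : R -> R) :
  {within `[0, 1], continuous D} ->
  (forall s t, 0 <= s <= 1 -> 0 <= t <= 1 -> G (D s - D t)) ->
  forall s, 0 <= s <= 1 -> D s = D 0.
Proof.
move=> cD GD s s01; have [d d0 gap] := discrete_subgroup_gap.
have z01 : 0 <= (0 : R) <= 1 by rewrite lexx ler01.
have ivt v : Num.min (D 0) (D s) <= v <= Num.max (D 0) (D s) ->
    exists2 c, 0 <= c <= 1 & D c = v.
  case/andP : s01 => s0 s1.
  have cD' : {within `[0, s], continuous D}.
    apply: continuous_subspaceW cD => t; rewrite /= !in_itv /=.
    by move=> /andP[-> /le_trans ->].
  move=> /(IVT s0 cD')[c]; rewrite in_itv /= => /andP[c0 cs] <-.
  by exists c => //; rewrite c0 (le_trans cs).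
apply: contrapT => /eqP; rewrite -subr_eq0 -normr_gt0 => Ds0.
(* A value strictly between [D 0] and [D s], less than the gap away from
   [D 0]. *)
pose h := Num.min 1 (d / (2 * `|D s - D 0|)).
have h0 : 0 < h by rewrite lt_min ltr01 divr_gt0// mulr_gt0.
have h1 : h <= 1 by rewrite ge_min lexx.
have hd : h * `|D s - D 0| < d.
  have : h <= d / (2 * `|D s - D 0|) by rewrite ge_min lexx orbT.
  rewrite ler_pdivlMr ?mulr_gt0// => hle.
  have d2 : 0 < d / 2 by rewrite divr_gt0.
  by rewrite mulrCA in hle; lra.
have [|c c01 Dc] := ivt (D 0 + h * (D s - D 0)).
  have [Dle|/ltW Dle] := leP (D 0) (D s).
    rewrite -lerBlDl subrr mulr_ge0 ?subr_ge0 ?(ltW h0)//=.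
    by rewrite -lerBrDl ler_piMl ?subr_ge0.
  rewrite -lerBlDl ler_niMl ?subr_le0//=.
  by rewrite -lerBrDl subrr mulr_ge0_le0 ?subr_le0// ltW.
have := gap _ (GD c 0 c01 z01).
rewrite Dc addrC addKr normrM gtr0_norm// => /(_ hd)/eqP.
by rewrite mulf_eq0 gt_eqF//= -normr_eq0 gt_eqF.
Qed.

End DiscreteSubgroup.

Section BranchPotential.
Context {R : realType} {I : finType} (T : I -> R -> R) (P : I -> set R).
Hypothesis gen : generates T P.
Variable i0 : I.

Let dT i x := deriv_in `[0, 1] (T i) x.

Definition branch_term (s : R) (k : nat) : R :=
  ln (dT i0 (iter k (T i0) 0)) - ln (dT i0 (iter k (T i0) s)).

(** [expR (- branch_potential s)] is the infinite product of the quotients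
    [dT i0 (T^k s) / dT i0 (T^k 0)] for [T := T i0]: the derivative of the
    Koenigs linearisation of the contraction [T], the limit of
    [(T^n s - T^n 0) / (T^n)'(0)]. *)
Definition branch_potential (s : R) : R := limn (series (branch_term s)).

Lemma iter_ifs_itv s k : 0 <= s <= 1 -> 0 <= iter k (T i0) s <= 1.
Proof. by move=> s01; elim: k => [//|k]; exact: (ifs_itv gen). Qed.

Lemma iter_ifs_dist : exists2 c : R, 0 < c < 1 &
  forall k s t, 0 <= s <= 1 -> 0 <= t <= 1 ->
  `|iter k (T i0) s - iter k (T i0) t| <= c ^+ k * `|s - t|.
Proof.
have [c c01 hc] := ifs_contracting gen; exists c => // k s t s01 t01.
elim: k => [|k IH]; first by rewrite expr0 mul1r.
rewrite /= (le_trans (hc _ _ _ _ _))//; do ?exact: iter_ifs_itv.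
by rewrite exprS -mulrA ler_wpM2l//; case/andP : c01 => /ltW.
Qed.

Lemma branch_ln_dist (a : R) : 0 < a ->
  holder_in a `[0, 1] (fun x => ln (dT i0 x)) ->
  exists C q, [/\ 0 <= C, 0 < q < 1 &
    forall k s t, 0 <= s <= 1 -> 0 <= t <= 1 ->
    `|ln (dT i0 (iter k (T i0) s)) - ln (dT i0 (iter k (T i0) t))| <=
    C * q ^+ k * `|s - t| `^ a].
Proof.
move=> a0 [C hC]; have [c /andP[c0 c1] hc] := iter_ifs_dist.
exists `|C|, (c `^ a); split=> // [|k s t s01 t01].
  have e1 : 1 `^ a = 1 :> R by rewrite powR1.
  by rewrite powR_gt0//= -e1 gt0_ltr_powR ?nnegrE// ltW.
rewrite (le_trans (hC _ _ _ _))//; do ?exact/itv01P/iter_ifs_itv.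
rewrite (le_trans (ler_wpM2r _ (ler_norm C)))// ?powR_ge0// -mulrA ler_wpM2l//.
have -> : (c `^ a) ^+ k = (c ^+ k) `^ a.
  by rewrite -powR_mulrn ?powR_ge0// -powRrM mulrC powRrM powR_mulrn// ltW.
rewrite -powRM ?exprn_ge0 ?(ltW c0)// ge0_ler_powR ?nnegrE ?mulr_ge0//.
- exact: ltW.
- by rewrite exprn_ge0// ltW.
- exact: hc.
Qed.

Lemma branch_series_cvg s : 0 <= s <= 1 -> cvgn (series (branch_term s)).
Proof.
move=> s01; have [a /andP[a0 _] ha] := ifs_ln_deriv_holder gen i0.
have [C [q [C0 /andP[q0 q1] hq]]] := branch_ln_dist a0 ha.
have z01 : 0 <= (0 : R) <= 1 by rewrite lexx ler01.
apply: normed_cvg; apply: (@series_le_cvg _ _ (geometric (C * `|0 - s| `^ a) q)).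
- by move=> n; rewrite normr_ge0.
- by move=> n; rewrite geometric_ge0 ?mulr_ge0 ?powR_ge0// ltW.
- by move=> n /=; rewrite mulrAC hq.
- by apply: is_cvg_geometric_series; rewrite ger0_norm// ltW.
Qed.

(** The [k]-th terms at [s] and [t] differ by at most
    [C * q ^+ k * `|s - t| `^ a], and the geometric series adds up to
    [C / (1 - q)]. *)
Lemma branch_potential_holder (a : R) : 0 < a ->
  holder_in a `[0, 1] (fun x => ln (dT i0 x)) ->
  holder_in a `[0, 1] branch_potential.
Proof.
move=> a0 ha; have [C [q [C0 /andP[q0 q1] hq]]] := branch_ln_dist a0 ha.
exists (C / (1 - q)) => s t /itv01P s01 /itv01P t01.
have cs := branch_series_cvg s01; have ct := branch_series_cvg t01.
have cst : `|series (branch_term s) n - series (branch_term t) n|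
    @[n --> \oo] --> `|branch_potential s - branch_potential t|.
  exact: (cvg_norm (cvgB cs ct)).
apply: (cvgr_to_le cst); apply: nearW => n.
have q1' : 0 < 1 - q by rewrite subr_gt0.
apply: (@le_trans _ _ (series (geometric (C * `|s - t| `^ a) q) n)).
  rewrite /series /= -sumrB; apply: le_trans (ler_norm_sum _ _ _) _.
  apply: ler_sum => k _; rewrite /=.
  have -> : branch_term s k - branch_term t k =
      ln (dT i0 (iter k (T i0) t)) - ln (dT i0 (iter k (T i0) s)).
    by rewrite /branch_term opprB addrC addrA subrK.
  by rewrite distrC mulrAC hq.
rewrite geometric_seriesE ?lt_eqF//= ler_pdivrMr//.
rewrite [leRHS](_ : _ = C * `|s - t| `^ a); last by field; rewrite gt_eqF.
rewrite ler_piMr ?mulr_ge0 ?powR_ge0//.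
by rewrite gerBl exprn_ge0// ltW.
Qed.

End BranchPotential.

Section Cohomology.
Context {R : realType} {I : finType} (T : I -> R -> R) (P : I -> set R).
Hypothesis gen : generates T P.
Variables (rho : R) (zeta phi : Sigma I -> R) (G : set R).
Hypotheses (rho01 : 0 < rho < 1) (phiF : F_class rho phi).
Hypothesis cob :
  forall x, geometric_potential T x - zeta x = phi x - phi (Defs.shift x).
Hypotheses (hG : discrete_subgroup G) (zetaG : forall x, G (zeta x)).
Implicit Types x y : Sigma I.

Let dT i (s : R) := deriv_in `[0, 1] (T i) s.

Lemma F_class_var : exists K, forall n x y, (0 < n)%N ->
  (forall j, (j < n)%N -> x j = y j) -> `|phi x - phi y| <= K * rho ^+ n.
Proof.
case: phiF => _; set S := ereal_sup _ => Sfin.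
exists (fine S) => n x y n0 xy.
have rn0 : 0 < rho ^+ n by rewrite exprn_gt0//; case/andP : rho01.
have h : ((rho ^- n * `|phi x - phi y|)%:E <= S)%E.
  apply: (@le_trans _ _ ((rho ^- n)%:E * var n phi)%E).
    rewrite EFinM lee_pmul2l ?lte_fin ?invr_gt0//.
    by apply: ereal_sup_ubound; exists x, y.
  by apply: ereal_sup_ubound; exists n.
have Sf : S \is a fin_num.
  by rewrite fin_numE -ltey Sfin andbT; case: (S) h.
by move: h; rewrite -(fineK Sf) lee_fin ler_pdivrMl// mulrC.
Qed.

(** The partial sums of [L s - L t] compare the Birkhoff sums of the geometric
    potential along [x] and [y] prefixed by [n] letters [i0].  After telescoping
    the coboundary, what is left besides [phi x - phi y] is a sum of values of
    [zeta], and a difference of values of [phi] at sequences with [n] common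
    letters, which tends to 0.  The limit stays in [G] since [G] is closed. *)
Lemma branch_potential_cohomology i0 x y s t : codes T x s -> codes T y t ->
  G (branch_potential T i0 s - branch_potential T i0 t + phi x - phi y).
Proof.
move=> xs yt.
have itc k z u : codes T z u ->
    codes T (iter k (scons i0) z) (iter k (T i0) u).
  by move=> zu; elim: k => [//|k]; exact: (codes_scons gen).
have step z u k : codes T z u -> - ln (dT i0 (iter k (T i0) u)) =
    zeta (iter k.+1 (scons i0) z) +
    (phi (iter k.+1 (scons i0) z) - phi (iter k (scons i0) z)).
  move=> zu; rewrite -(geometric_potential_scons gen i0 (itc k z u zu)).
  by have := cob (iter k.+1 (scons i0) z); rewrite iterS shift_scons => <-; ring.
pose X n := iter n (scons i0) x; pose Y n := iter n (scons i0) y.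
pose p n := phi (X n) - phi (Y n).
have termE k : branch_term T i0 s k - branch_term T i0 t k =
    (zeta (X k.+1) - zeta (Y k.+1)) + (p k.+1 - p k).
  have regroup (z1 z2 u1 u2 v1 v2 : R) : (z1 + (u1 - v1)) - (z2 + (u2 - v2)) =
      (z1 - z2) + ((u1 - u2) - (v1 - v2)) by ring.
  rewrite -regroup -(step _ _ k xs) -(step _ _ k yt) /branch_term.
  by rewrite opprB addrC addrA subrK opprK addrC.
have sumE n : series (branch_term T i0 s) n - series (branch_term T i0 t) n =
    \sum_(0 <= k < n) (zeta (X k.+1) - zeta (Y k.+1)) + (p n - p 0%N).
  rewrite /series /= -sumrB (eq_bigr _ (fun k _ => termE k)) big_split /=.
  by rewrite telescope_sumr.
have p_cvg0 : p n @[n --> \oo] --> (0 : R).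
  have [K hK] := F_class_var.
  have XY n j : (j < n)%N -> X n j = Y n j.
    by elim: n j => [//|n IH] [|j] //= jn; exact: IH.
  apply/norm_cvg0P; apply: (@squeeze_cvgr _ _ _ _ (cst 0) (fun n => K * rho ^+ n)).
  - exists 1%N => // n /= n1; rewrite normr_ge0/=.
    by apply: hK => // j; exact: XY.
  - exact: cvg_cst.
  - rewrite -(mulr0 K); apply: cvgM; first exact: cvg_cst.
    by apply: cvg_expr; case/andP : rho01 => ? ?; rewrite gtr0_norm.
have cs := @branch_series_cvg _ _ _ _ gen i0 s (codes_itv xs).
have ct := @branch_series_cvg _ _ _ _ gen i0 t (codes_itv yt).
apply: (@discrete_subgroup_cvg _ _ hG
  (fun n => \sum_(0 <= k < n) (zeta (X k.+1) - zeta (Y k.+1)))).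
  move=> n; apply: (discrete_subgroup_sum hG) => k.
  by case: hG => _ GB _; exact: GB.
have lim3 (u v w : nat -> R) (lu lv c : R) : u n @[n --> \oo] --> lu ->
    v n @[n --> \oo] --> lv -> w n @[n --> \oo] --> (0 : R) ->
    u n - v n - w n + c @[n --> \oo] --> lu - lv + c.
  move=> ulu vlv w0; rewrite -[lu - lv]subr0.
  by apply: cvgD; [apply: cvgB; [exact: cvgB|]|exact: cvg_cst].
have := lim3 _ _ _ _ _ (p 0%N) cs ct p_cvg0.
rewrite -[_ + phi x - _]addrA.
suff -> : (fun n => series (branch_term T i0 s) n -
    series (branch_term T i0 t) n - p n + p 0%N) =
  (fun n => \sum_(0 <= k < n) (zeta (X k.+1) - zeta (Y k.+1))) by [].
apply/funext => n; rewrite sumE.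
have cancel (z u v : R) : z + (u - v) - u + v = z by ring.
exact: cancel.
Qed.

(** Subtracting [branch_potential_cohomology] for [x], [y] from the same fact
    for [scons j x], [scons j y] cancels every value of [phi], by the coboundary
    equation; so the increments of the continuous function [D] below lie in [G],
    and [D] is constant. *)
Lemma derivative_coboundary : exists2 a : R, 0 < a < 1 &
  exists2 L, holder_in a `[0, 1] L &
  forall j, exists2 lam, 0 < lam &
    forall s, 0 <= s <= 1 -> dT j s = lam * expR (L (T j s) - L s).
Proof.
have [i0] := ifs_inhabited gen.
have [a a01 ha] := ifs_ln_deriv_holder gen i0.
have a0 : 0 < a by case/andP : a01.
exists a => //; set L := branch_potential T i0.
have hL : holder_in a `[0, 1] L := branch_potential_holder gen a0 ha.
exists L => // j.
pose D s := - ln (dT j s) + L (T j s) - L s.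
have DG s t : 0 <= s <= 1 -> 0 <= t <= 1 -> G (D s - D t).
  move=> /(codes_exists gen)[x xs] /(codes_exists gen)[y yt].
  have H1 := branch_potential_cohomology i0 (codes_scons gen j xs)
    (codes_scons gen j yt).
  have H2 := branch_potential_cohomology i0 xs yt.
  have cx := cob (scons j x); have cy := cob (scons j y).
  rewrite shift_scons (geometric_potential_scons gen j xs) in cx.
  rewrite shift_scons (geometric_potential_scons gen j yt) in cy.
  have [_ GB _] := hG.
  have regroup (e e' z z' p p' q q' u u' v v' : R) :
      e - z = p - q -> e' - z' = p' - q' ->
      (e + u - v) - (e' + u' - v') =
      (z - z') + ((u - u' + p - p') - (v - v' + q - q')).
    by move=> /(canRL (subrK _)) -> /(canRL (subrK _)) ->; ring.
  rewrite /D (regroup _ _ _ _ _ _ _ _ _ _ _ _ cx cy).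
  apply: (discrete_subgroupD hG); last exact: GB H1 H2.
  exact: GB (zetaG (scons j x)) (zetaG (scons j y)).
have cD : {within `[0, 1], continuous D}.
  have [b /andP[b0 _] /(holder_in_continuous b0) cdT] := ifs_ln_deriv_holder gen j.
  have cL := holder_in_continuous a0 hL.
  have [K /andP[/ltW K0 _] hK] := ifs_contracting gen.
  have cLT : {within `[0, 1], continuous (L \o T j)}.
    apply: (holder_in_continuous a0).
    apply: (holder_in_comp_lipschitz (ltW a0) K0 _ (hK j) hL).
    by move=> x; exact: (ifs_itv gen).
  have comb (u v w : R -> R) : {within `[0, 1], continuous u} ->
      {within `[0, 1], continuous v} -> {within `[0, 1], continuous w} ->
      {within `[0, 1], continuous (fun x : R => - u x + v x - w x)}.
    move=> /subspace_continuousP cu /subspace_continuousP cv.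
    move=> /subspace_continuousP cw; apply/subspace_continuousP => x x01.
    apply: cvgB; last exact: cw.
    by apply: cvgD; [apply: cvgN; exact: cu|exact: cv].
  exact: comb cdT cLT cL.
have Dc := continuous_discrete_const hG cD DG.
exists (expR (- D 0)) => [|s s01]; first exact: expR_gt0.
rewrite -expRD -(Dc s s01) /D.
have cancel (u v w : R) : - (- u + v - w) + (v - w) = u by ring.
by rewrite cancel lnK// posrE; exact: (ifs_deriv_gt0 gen).
Qed.

End Cohomology.

(** * Affine systems and the linearising chart *)

Section AffineBranch.
Context {R : realType} (l b : R).
Hypothesis l0 : 0 < l.

Let f (y : R) := l * y + b.

Lemma affine_mono : {in `[0, 1] &, {homo f : x y / x < y}}.
Proof. by move=> x y _ _ xy; rewrite /f ltrD2r ltr_pM2l. Qed.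

Lemma affine_image : f @` `[0, 1] = `[b, l + b]%classic.
Proof.
apply/seteqP; split=> [_ [x /= + <-]|y /=]; rewrite !in_itv /=.
  move=> /andP[x0 x1]; rewrite /f lerDr mulr_ge0 ?(ltW l0)//=.
  by rewrite lerD2r ger_pMr.
move=> /andP[y0 y1]; exists ((y - b) / l); last by rewrite /f; field; rewrite gt_eqF.
rewrite /= in_itv /= divr_ge0 ?subr_ge0 ?(ltW l0)//=.
by rewrite ler_pdivrMr// mul1r lerBlDr.
Qed.

Lemma affine_image_Ico : f @` `[0, 1[ = `[b, l + b[%classic.
Proof.
have ble : b <= l + b by rewrite lerDr ltW.
by have [_ _ ->] := increasing_image_Ico affine_mono affine_image ble;
  rewrite /f mulr0 add0r mulr1.
Qed.

Lemma deriv_in_affine x : 0 <= x <= 1 -> deriv_in `[0, 1] f x = l.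
Proof.
move=> x01; apply: has_deriv_in_eq; first exact/limit_point_itv01/itv01P.
exact: has_deriv_in_affine.
Qed.

Lemma affine_bij : set_bij `[0, 1] (f @` `[0, 1]) f.
Proof.
split=> [x x01|x y _ _ /addIr /mulfI -> //|//]; first by exists x.
by rewrite gt_eqF.
Qed.

Lemma affine_C1 : C1_in `[0, 1] f.
Proof.
suff [] : C1holder_in 1 `[0, 1] f by [].
apply: (@C1holder_inI _ _ _ _ (fun=> l)) => //.
- exact: limit_point_itv01.
- by move=> x _; exact: has_deriv_in_affine.
- exact: holder_in_cst.
Qed.

Lemma affine_inverse_C1holder (a : R) : 0 < a ->
  C1holder_in a (f @` `[0, 1]) (inverse_on `[0, 1] f).
Proof.
move=> a0; apply: (@C1holder_inI _ _ _ _ (fun=> l^-1)) => //;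
  last exact: holder_in_cst.
  rewrite affine_image => x; rewrite /= in_itv /=.
  by apply: limit_point_itvcc; rewrite ltrDr.
move=> x Bx; apply: (@has_deriv_in_ext _ _ (fun y => l^-1 * y + (- (l^-1 * b)))).
- exact: Bx.
- move=> _ /set_mem[y y01 <-]; have [_ inj _] := affine_bij.
  by rewrite /inverse_on pinvKV ?inE// /f; field; rewrite gt_eqF.
- exact: has_deriv_in_affine.
Qed.

End AffineBranch.

Lemma affine_generates (R : realType) (I : finType) (l b : I -> R) (c : R) :
  c < 1 -> (forall i, 0 < l i < c) ->
  (forall i, 0 <= b i /\ l i + b i <= 1) ->
  (forall i j, i != j ->
    (`[b i, l i + b i[%classic : set R) `&` `[b j, l j + b j[ = set0) ->
  \bigcup_i (`[b i, l i + b i[%classic : set R) = `[0, 1[%classic ->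
  generates (fun i y => l i * y + b i)
    (fun i => (fun y => l i * y + b i) @` `[0, 1]).
Proof.
move=> c1 lc b01 dis cover.
have l0 i : 0 < l i by case/andP : (lc i).
split.
- split=> // i; exists (b i), (l i + b i); have [? ?] := b01 i.
  by split; rewrite ?affine_image// lerDr ltW.
- by move=> i j ij; rewrite !affine_image_Ico//; exact: dis.
- under eq_bigr do rewrite affine_image_Ico//.
  by rewrite -measure_bigcup_Ico// cover lebesgue_measure_itv /= lte_fin ltr01
    oppr0 adde0.
- move=> i; split.
  + exact: affine_mono.
  + split; first exact: affine_bij.
      exact: affine_C1.
    by case: (affine_inverse_C1holder (b i) (l0 i) ltr01).
  + by move=> x x01; rewrite deriv_in_affine//; move: x01; rewrite in_itv.
  + exists (1 / 2); first by apply/andP; split; lra.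
    by apply: affine_inverse_C1holder => //; lra.
- have [i0|noI] := pselect (inhabited I); last first.
    exists (1 / 2); first by apply/andP; split; lra.
    by move=> i; case: noI; exists.
  exists c; first by case: i0 => i; case/andP: (lc i) => ? ?; apply/andP; split; lra.
  by move=> i x; rewrite in_itv /= => x01; rewrite deriv_in_affine.
Qed.

Section Linearisation.
Context {R : realType} {I : finType} (T : I -> R -> R) (P : I -> set R).
Hypothesis gen : generates T P.
Variables (a : R) (M F : R -> R) (lam : I -> R).
Hypotheses (a0 : 0 < a) (hM : holder_in a `[0, 1] M) (F0 : F 0 = 0) (F1 : F 1 = 1).
Hypothesis dF :
  forall x, 0 <= x <= 1 -> has_deriv_in `[0, 1] F x (expR (- M x)).
Hypothesis lam0 : forall i, 0 < lam i.
Hypothesis dT : forall i s, 0 <= s <= 1 ->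
  deriv_in `[0, 1] (T i) s = lam i * expR (M (T i s) - M s).

Let b i := F (T i 0).
Let G := inverse_on `[0, 1] F.

(** Both sides have the same derivative: the factor [expR (M (T i s) - M s)] in
    [dT] is what is needed to turn [F' (T i s)] into [F' s]. *)
Lemma linearised_branch i s : 0 <= s <= 1 -> F (T i s) = lam i * F s + b i.
Proof.
move=> s01.
have D0 x : 0 <= x <= 1 ->
    has_deriv_in `[0, 1] (fun y => F (T i y) - lam i * F y) x 0.
  move=> x01; have dTx := @ifs_has_deriv _ _ _ _ gen i x x01.
  have comp : has_deriv_in `[0, 1] (F \o T i) x
      (expR (- M (T i x)) * (lam i * expR (M (T i x) - M x))).
    rewrite -dT//; apply: (@has_deriv_in_comp _ _ `[0, 1]) dTx _.
    - by move=> y /itv01P /(ifs_itv gen i) /itv01P.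
    - exact/itv01P.
    - by apply: dF; exact: (ifs_itv gen).
  have := @has_deriv_in_lincomb _ _ _ _ _ _ _ (lam i) comp (dF x01).
  by rewrite mulrCA -expRD addKr subrr.
have := has_deriv_in_eq0_const D0 s01.
by rewrite F0 mulr0 subr0 => /eqP; rewrite subr_eq addrC => /eqP.
Qed.

Let ends i : 0 <= T i 0 /\ T i 0 < T i 1 /\ T i 1 <= 1.
Proof.
have [? [? _]] := ifs_image gen i; split=> //; split=> //.
by apply: (ifs_mono gen) => //; rewrite ltr01.
Qed.

Let lamE i : lam i + b i = F (T i 1).
Proof. by rewrite linearised_branch ?F1 ?mulr1// ler01 lexx. Qed.

(** The complement of the image of [T i] has length at least [1 - c], where [c]
    is the contraction ratio, and [F] shrinks it at most by the factor [m]. *)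
Lemma ratio_lt1 : exists2 c : R, c < 1 & forall i, lam i < c.
Proof.
have [m m0 hm] := chart_expanding a0 hM dF.
have [c /andP[c0 c1] hc] := ifs_contracting gen.
have k0 : 0 < m * (1 - c) by rewrite mulr_gt0// subr_gt0.
exists (1 - m * (1 - c) / 2); first lra.
move=> i; have [t0 [t01 t1]] := ends i.
have h0 := hm _ _ (lexx 0) t0 (ltW (lt_le_trans t01 t1)).
have h1 := hm _ _ (le_trans t0 (ltW t01)) t1 (lexx 1).
have h2 : T i 1 - T i 0 <= c.
  have := hc i 1 0 ltac:(by rewrite ler01 lexx) ltac:(by rewrite lexx ler01).
  by rewrite subr0 normr1 mulr1; apply: le_trans; exact: ler_norm.
have h3 : m * (T i 1 - T i 0) <= m * c by rewrite ler_pM2l.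
have := lamE i; rewrite /b => lE.
rewrite F0 in h0; rewrite F1 in h1.
rewrite mulrBr mulr1 in k0 *; rewrite !mulrBr mulr1 mulr0 in h0 h1 h3.
lra.
Qed.

(** On [[0, 1[], the chart carries the half-open images of the branches [T i]
    onto those of their linearisations; disjointness and covering are therefore
    inherited, and the total length 1 is that of the disjoint union
    [[0, 1[]. *)
Lemma linearised_generates :
  generates (fun i y => lam i * y + b i)
    (fun i => (fun y => lam i * y + b i) @` `[0, 1]).
Proof.
have [c c1 lc] := ratio_lt1.
have GK y : 0 <= y <= 1 -> F (G y) = y by exact: (chart_inverseK a0 hM F0 F1 dF).
have G01 y : 0 <= y <= 1 -> 0 <= G y <= 1.
  exact: (chart_inverse_itv a0 hM F0 F1 dF).
have Fitv x : 0 <= x <= 1 -> 0 <= F x <= 1 by exact: (chart_itv a0 hM F0 F1 dF).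
have Flt x y := @chart_mono R a M F a0 hM dF x y.
have Fle x y : 0 <= x -> x <= y -> y <= 1 -> F x <= F y.
  by move=> x0; rewrite le_eqVlt => /predU1P[->//|xy] y1; rewrite ltW// Flt.
have Glt1 y : 0 <= y < 1 -> 0 <= G y < 1.
  move=> /andP[y0 y1]; have y01 : 0 <= y <= 1 by rewrite y0 ltW.
  have /andP[-> g1] := G01 y y01; rewrite lt_neqAle g1 andbT /=.
  by apply/eqP => g1E; move: y1; rewrite -(GK y y01) g1E F1 ltxx.
have sub01 i y : (`[b i, lam i + b i[%classic : set R) y -> 0 <= y < 1.
  have [t0 [t01 t1]] := ends i; rewrite lamE /= in_itv /= => /andP[hl hr].
  apply/andP; split.
    by apply: le_trans hl; rewrite -[leLHS]F0 /b Fle// (le_trans (ltW t01)).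
  by apply: (lt_le_trans hr); rewrite -[leRHS]F1 Fle// (le_trans t0 (ltW t01)).
have pull i y : 0 <= y < 1 ->
    (`[b i, lam i + b i[%classic : set R) y <-> (T i @` `[0, 1[) (G y).
  move=> /andP[y0 y1]; have y01 : 0 <= y <= 1 by rewrite y0 ltW.
  have [t0 [t01 t1]] := ends i; have [_ [_ [_ ->]]] := ifs_image gen i.
  have /andP[g0 g1] := G01 y y01.
  rewrite lamE /b /= !in_itv /= -{1 2}(GK y y01); split=> /andP[hl hr].
    apply/andP; split; [rewrite leNgt|rewrite ltNge]; apply/negP => h.
      by move: hl; rewrite leNgt Flt// (le_trans (ltW t01)).
    by move: hr; rewrite ltNge Fle// (le_trans t0 (ltW t01)).
  by rewrite Fle//= Flt.
apply: (@affine_generates _ _ _ _ c) => //.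
- by move=> i; rewrite lam0 lc.
- move=> i; rewrite lamE; have [t0 [t01 t1]] := ends i.
  have /andP[h0 _] : 0 <= b i <= 1.
    by apply: Fitv; rewrite t0 (le_trans (ltW t01)).
  have /andP[_ h1] : 0 <= F (T i 1) <= 1.
    by apply: Fitv; rewrite t1 (le_trans t0 (ltW t01)).
  by [].
- move=> i j ij; apply/seteqP; split=> // y [yi yj].
  have y01 : 0 <= y < 1 by exact: sub01 yi.
  move: yi yj => /(pull i y y01) yi /(pull j y y01) yj.
  case: (gen) => _ /(_ i j ij) dis _ _ _.
  suff : (T i @` `[0, 1[ `&` T j @` `[0, 1[) (G y) by rewrite dis.
  by split.
- apply/seteqP; split=> [y [i _]|y]; first by rewrite /= in_itv; exact: sub01.
  rewrite /= in_itv /= => y01.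
  have [i g0 g1] := ifs_cover_Ico gen (Glt1 y y01); exists i => //.
  apply/(pull i y y01); have [_ [_ [_ ->]]] := ifs_image gen i.
  by rewrite /= in_itv /= g0.
Qed.

End Linearisation.

Theorem theorem4p6 (R : realType) (I : finType) (T : I -> R -> R)
    (P : I -> set R) :
  generates T P ->
  lattice (geometric_potential T) ->
  exists (Pl : I -> set R) (Tl : I -> R -> R),
    [/\ generates Tl Pl,
        forall i, affine_on `[0, 1] (Tl i) &
        exists (alpha : R) (g : R -> R),
          [/\ 0 < alpha < 1,
              C1holder_diffeo alpha `[0, 1] `[0, 1] g &
              forall i (x : R), x \in `[0, 1] ->
                T i x = g (Tl i (inverse_on `[0, 1] g x))]].
Proof.
move=> gen [rho rho01 [zeta [_ _ [phi [phiF _] cob]] [G hG zetaG]]].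
have [a a01 [L hL cobL]] := derivative_coboundary gen rho01 phiF cob hG zetaG.
have /choice[lam lamP] : forall i, exists l : R, 0 < l /\ forall s, 0 <= s <= 1 ->
    deriv_in `[0, 1] (T i) s = l * expR (L (T i s) - L s).
  by move=> i; have [l l0 hl] := cobL i; exists l.
have a0 : 0 < a by case/andP : a01.
have [k [F [F0 F1 dF]]] := normalised_antiderivative a0 hL.
pose M x := L x + k.
have hM : holder_in a `[0, 1] M.
  have [C hC] := hL; exists C => x y x01 y01.
  by rewrite /M opprD addrACA subrr addr0; exact: hC.
have lam0 i : 0 < lam i by case: (lamP i).
have dT i s : 0 <= s <= 1 ->
    deriv_in `[0, 1] (T i) s = lam i * expR (M (T i s) - M s).
  move=> s01; case: (lamP i) => _ ->//.
  by rewrite /M opprD addrACA subrr addr0.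
pose Tl i (y : R) := lam i * y + F (T i 0).
exists (fun i => Tl i @` `[0, 1]), Tl; split.
- exact: (linearised_generates gen a0 hM F0 F1 dF lam0 dT).
- by move=> i; exists (lam i), (F (T i 0)).
exists a, (inverse_on `[0, 1] F); split=> //.
  exact: (chart_inverse_diffeo a0 hM F0 F1 dF).
move=> i x; rewrite in_itv /= => x01.
rewrite (inverse_on_chart_inverse a0 hM F0 F1 dF x01) /Tl.
rewrite -(linearised_branch gen F0 dF dT i x01).
by rewrite (chartK a0 hM F0 F1 dF)//; exact: (ifs_itv gen).
Qed.
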